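(* Let $\beta$ and $\gamma$ be two nonzero real numbers, let $G$ and $G'$ be two regular graphs on $n$ vertices, and let $1\le k\le n$. Then the following two statements are equivalent: (i) $\operatorname{Imm}_{(k,1^{n-k})}(xI-A(G))=\operatorname{Imm}_{(k,1^{n-k})}(xI-A(G'))$. (ii) $\operatorname{Imm}_{(k,1^{n-k})}(xI-\beta D(G)-\gamma A(G))=\operatorname{Imm}_{(k,1^{n-k})}(xI-\beta D(G')-\gamma A(G'))$.
   Context: Graphs are finite and simple. $D(G)$ is the diagonal degree matrix and $A(G)$ the adjacency matrix of $G$; $I$ is the $n\times n$ identity matrix. For a partition $\lambda$ of $n$, $\chi_\lambda$ is the irreducible character of the symmetric group $\mathcal{S}_n$ indexed by $\lambda$ (so $(n)$ gives the trivial and $(1^n)$ the sign character), and $\operatorname{Imm}_\lambda(M)=\sum_{\sigma\in\mathcal{S}_n}\chi_\lambda(\sigma)\prod_{i=1}^n m_{i\sigma(i)}$ for an $n\times n$ matrix $M=[m_{ij}]$. The equalities are equalities of polynomials in $x$. The two graphs are not assumed to be regular of the same degree. *)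

(* Defs.v *)
From HB Require Import structures.
From mathcomp Require Import all_boot all_order all_algebra all_fingroup.
From mathcomp Require Import mxrepresentation.
From mathcomp Require Import reals.

Set Implicit Arguments.
Unset Strict Implicit.
Unset Printing Implicit Defensive.

Import GRing.Theory.
Local Open Scope ring_scope.

Record sgraph (n : nat) := SGraph {
  adj :> rel 'I_n;
  adj_sym : symmetric adj;
  adj_irr : irreflexive adj }.

Definition deg n (G : sgraph n) (v : 'I_n) : nat := #|[set w | G v w]|.

Definition regular n (G : sgraph n) : Prop := exists d : nat, forall v, deg G v = d.

Definition adj_mx (R : nzRingType) n (G : sgraph n) : 'M[R]_n :=
  \matrix_(i, j) (G i j)%:R.

Definition deg_mx (R : nzRingType) n (G : sgraph n) : 'M[R]_n :=
  diag_mx (\row_i (deg G i)%:R).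

(* Partitions are the non-increasing sequences of positive parts. *)
Definition is_partition (n : nat) (la : seq nat) : bool :=
  [&& sorted geq la, 0%N \notin la & sumn la == n].

Definition hook (n k : nat) : seq nat := k :: nseq (n - k) 1%N.

Lemma hook_is_partition n k : (1 <= k <= n)%N -> is_partition n (hook n k).
Proof.
case/andP=> k_gt0 le_kn; apply/and3P; split.
- rewrite /hook /=; elim: (n - k)%N {1 2}k k_gt0 => //= m IHm j j_gt0.
  by rewrite IHm // andbT.
- by rewrite inE mem_nseq andbF orbF eq_sym -lt0n.
- by rewrite /= sumn_nseq mul1n subnKC.
Qed.

(* The cells of the Young diagram of la are numbered 0, ..., n-1 row by row:
   cell i is in row reshape_index la i and column reshape_offset la i. *)
Definition row_stab n (la : seq nat) : {set 'S_n} :=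
  [set s : 'S_n | [forall i : 'I_n,
     reshape_index la (s i) == reshape_index la i]].

Definition col_stab n (la : seq nat) : {set 'S_n} :=
  [set s : 'S_n | [forall i : 'I_n,
     reshape_offset la (s i) == reshape_offset la i]].

(* The Young symmetrizer: the sum of sgn(q) p q in the group algebra F[S_n],
   p and q ranging over the row and column stabilizers of the tableau above. *)
Definition young_symmetrizer (F : fieldType) n (la : seq nat) :
    'rV[F]_#|[set: 'S_n]%G| :=
  \sum_(p in row_stab n la) \sum_(q in col_stab n la)
    (-1) ^+ q *: gring_row (regular_repr F [set: 'S_n]%G (p * q)%g).

(* The irreducible module indexed by la is the right ideal of F[S_n] generated
   by the Young symmetrizer (mathcomp representations act on the right).
   For F of characteristic 0 it is absolutely irreducible, so that its
   character is chi_la whatever F; (n) gives the trivial character and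
   (1^n) the sign. *)
Definition specht_repr (F : fieldType) n (la : seq nat) :=
  submod_repr (cyclic_mx_module (regular_repr F [set: 'S_n]%G)
                                (young_symmetrizer F n la)).

Definition sym_char (F : fieldType) n (la : seq nat) (s : 'S_n) : F :=
  \tr (specht_repr F n la s).

Definition immanant (F : fieldType) (A : comAlgType F) n (la : seq nat)
    (M : 'M[A]_n) : A :=
  \sum_(s : 'S_n) sym_char F la s *: \prod_(i < n) M i (s i).

Arguments immanant {F A n} la M.
Arguments adj_mx R {n} G.
Arguments deg_mx R {n} G.

(* Main.v *)
Require Import Defs.
From mathcomp Require Import all_boot all_order all_algebra all_fingroup.
From mathcomp Require Import reals.
From mathcomp Require Import mxrepresentation primitive_action alt.
From mathcomp Require Import zify ring.

Set Implicit Arguments.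
Unset Strict Implicit.
Unset Printing Implicit Defensive.

Import Order.TTheory GRing.Theory Num.Theory.
Local Open Scope ring_scope.

(** Write N for the number of vertices and P_A for the immanant of xI - A.  For a
    graph that is regular of degree d the matrix xI - beta D - gamma A is (x - beta d)I - gamma A, whose immanant
    is gamma^N P_A((x - beta d) / gamma).  Hence the two statements are equivalent
    as soon as both graphs have the same degree, and the point is that each of
    them determines d.

    For (ii) this is immediate: the coefficient of x^(N-1) is
    - chi(1) N beta d, and chi(1) is not 0 ([coef_immanant_XsubC]).

    For (i), the coefficient of x^(N-j) in P_A is a sum over the permutations moving exactly j points ([coef_immanant]).
    The transpositions give chi((1 2)) times the number of edges, which is enough
    unless chi((1 2)) = 0, that is, unless the hook is self-conjugate:
    N = 2k - 1.  In that case chi vanishes on odd permutations up to inversion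
    ([hook_charV]), so the coefficient of x^(N-4) only sees the products of two
    disjoint transpositions: it is chi((1 2)(3 4)) times the number of pairs of
    disjoint edges, which for N >= 5 is a strictly increasing function of d
    ([two_pair_count_inj]).  Two small cases are left: one vertex, and the hook
    (2,1) on three vertices.  A regular graph on three vertices is empty or
    complete, and these are told apart by the value at x = -1, where the complete
    graph gives (-1)^N times the sum of all the values of chi, which is 0
    ([hook_immanant_complete]).

    The character values come straight from the Young symmetrizer c, seen as a
    function on the group.  Von Neumann's lemma gives c * c = kappa c with kappa
    nonzero, so that left multiplication by c / kappa is a projection onto the
    right ideal generated by c, and computing a trace gives
    chi(s) = kappa^-1 sum_g c(s^-1 ^ g) ([hook_charE]).  At a transposition or a
    product of two disjoint transpositions, c is the weight [hook_pair], or a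
    product of two such weights, so the sum over g becomes a sum over pairs or
    over quadruples of distinct points.  The same two sums, [pair_sum] and
    [two_pair_sum], count edges and pairs of disjoint edges when they are
    evaluated at an adjacency matrix, and one formula ([two_pair_sumE]) serves
    both purposes. *)

(** * Characters of right ideals of a group algebra *)

(** A full-rank factorization A = K L turns A^2 = 0 into L K = 0, and the trace of
    K L is that of L K. *)
Lemma mxtrace_sqr0 (F : fieldType) n (A : 'M[F]_n) : A *m A = 0 -> \tr A = 0.
Proof.
have [B] := row_freeP (row_base_free A).
have [C] : exists C, C *m col_base A = 1%:M by exact/row_fullP/col_base_full.
have := mulmx_base A; move: (col_base A) (row_base A) => K L AE CK LB A2.
rewrite -AE mxtrace_mulC; suff -> : L *m K = 0 by rewrite mxtrace0.
transitivity (C *m (K *m L *m (K *m L)) *m B); last by rewrite AE A2 mulmx0 mul0mx.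
by rewrite !mulmxA CK mul1mx -!mulmxA LB mulmx1.
Qed.

(** A projection P onto the module U computes traces on U: the endomorphism of U
    induced by M has the trace of P M.  This avoids choosing a basis of U. *)
Lemma mxtrace_in_submod (F : fieldType) n (U P M : 'M[F]_n) :
    (U :=: P)%MS -> P *m P = P -> (U *m M <= U)%MS ->
  \tr (in_submod U (val_submod (1%:M : 'M_(\rank U)) *m M)) = \tr (P *m M).
Proof.
move=> UP P2 UM; set B := val_submod 1%:M; set Z := in_submod _ _.
have BU : (B <= U)%MS by apply: val_submodP.
have BP : B *m P = B.
  have: (B <= P)%MS by rewrite -UP.
  by case/submxP=> D ->; rewrite -mulmxA P2.
have PU : (P <= U)%MS by rewrite UP.
have PB : in_submod U P *m B = P.
  by rewrite -[RHS](in_submodK PU) val_submodE.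
have ZB : Z *m B = B *m M.
  rewrite -[LHS]val_submodE in_submodK //.
  by apply: submx_trans UM; apply: submxMr.
have BP1 : B *m in_submod U P = 1%:M.
  by rewrite in_submodE mulmxA BP -in_submodE val_submodK.
transitivity (\tr (in_submod U P *m (B *m M))); last by rewrite mulmxA PB.
by rewrite [RHS]mxtrace_mulC -ZB -(mulmxA Z) BP1 mulmx1.
Qed.

Section GroupAlgebra.

Variables (F : fieldType) (gT : finGroupType).
Implicit Types (c : gT -> F).
Let G := [set: gT]%G.
Let rG := regular_repr F G.
Let idx (g : gT) : 'I_#|G| := gring_index G g.

Definition gconv c1 c2 (g : gT) : F := \sum_h c1 (g * h^-1)%g * c2 h.

Definition gvec c : 'rV[F]_#|G| := \sum_g c g *: gring_row (rG g).

(** Row i is the product of the element with coefficients c by the i-th group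
    element, so this is left multiplication by c, acting on row vectors. *)
Definition gmulmx c : 'M[F]_#|G| :=
  \matrix_(i, j) c (enum_val j * (enum_val i)^-1)%g.

Lemma gvecE c j : gvec c 0 j = c (enum_val j).
Proof.
rewrite summxE (bigD1 (enum_val j)) //= big1 ?addr0 => [|g gj].
  by rewrite mxE /gring_row !rowK gring_indexK ?inE // mul1g gring_valK mxE !eqxx mulr1.
rewrite mxE /gring_row !rowK gring_indexK ?inE // mul1g mxE eqxx /=.
case: eqP => [jE|]; last by rewrite mulr0.
by rewrite jE gring_indexK ?inE // eqxx in gj.
Qed.

Lemma gvec_mul c g j : (gvec c *m rG g) 0 j = c (enum_val j * g^-1)%g.
Proof.
rewrite mxE (bigD1 (idx (enum_val j * g^-1))) //= big1 ?addr0 => [|i iN].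
  rewrite gvecE mxE gring_indexK ?inE // mulgKV gring_valK.
  by rewrite mxE !eqxx mulr1.
rewrite [X in _ * X]mxE mxE eqxx /=.
case: eqP => [jE|]; last by rewrite mulr0.
by rewrite jE gring_indexK ?inE // mulgK /idx gring_valK eqxx in iN.
Qed.

Lemma row_gmulmx c i : row i (gmulmx c) = gvec c *m rG (enum_val i).
Proof. by apply/rowP=> j; rewrite gvec_mul !mxE. Qed.

Lemma gmulmx_conv c1 c2 : gmulmx c1 *m gmulmx c2 = gmulmx (gconv c2 c1).
Proof.
apply/matrixP=> i j; rewrite !mxE /gconv.
rewrite (reindex_onto enum_val idx) /=; last by move=> g _; rewrite /idx gring_indexK ?inE.
under [RHS]eq_bigl => k do rewrite /idx gring_valK eqxx.
rewrite (reindex_inj (h := fun k => idx (enum_val k * (enum_val i)))) /=; last first.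
  move=> k l /(congr1 enum_val); rewrite /idx !gring_indexK ?inE //.
  by move/mulIg/enum_val_inj.
apply: eq_bigr => k _; rewrite !mxE /idx gring_indexK ?inE // mulgK mulrC.
by rewrite invMg mulgA.
Qed.

(** Left multiplication by c has the right ideal generated by c as its image. *)
Lemma cyclic_gvec c : (cyclic_mx rG (gvec c) :=: gmulmx c)%MS.
Proof.
have modL : mxmodule rG (gmulmx c).
  apply/mxmoduleP=> x _; apply/row_subP=> i.
  rewrite row_mul row_gmulmx -mulmxA -repr_mxM ?inE //.
  suff -> : (enum_val i * x)%g = enum_val (idx (enum_val i * x)).
    by rewrite -row_gmulmx row_sub.
  by rewrite gring_indexK ?inE.
apply/eqmxP/andP; split.
  apply: cyclic_mx_sub => //.
  suff -> : gvec c = row (idx 1) (gmulmx c) by apply: row_sub.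
  by rewrite row_gmulmx gring_indexK ?inE // repr_mx1 mulmx1.
apply/row_subP=> i; rewrite row_gmulmx.
by rewrite mxmodule_trans ?cyclic_mx_module ?cyclic_mx_id ?inE.
Qed.

Variables (c : gT -> F) (kappa : F).
Hypothesis cc : forall g, gconv c c g = kappa * c g.

(** If kappa were 0 then left multiplication by c would square to 0, hence have
    trace 0; but all its diagonal entries are c(1). *)
Lemma quasi_idempotent_neq0 : c 1%g != 0 -> #|G|%:R != 0 :> F -> kappa != 0.
Proof.
move=> c1 oG; apply/eqP=> kappa0.
have := @mxtrace_sqr0 _ _ (gmulmx c); rewrite gmulmx_conv.
have -> : gmulmx (gconv c c) = 0.
  by apply/matrixP=> i j; rewrite !mxE cc kappa0 mul0r.
move/(_ erefl)/eqP; rewrite /mxtrace.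
under eq_bigr => i _ do rewrite mxE mulgV.
by rewrite sumr_const card_ord -[_ *+ _]mulr_natl mulf_eq0 (negPf oG) (negPf c1).
Qed.

(** Left multiplication by c / kappa is a projection onto the right ideal generated
    by c, and it commutes with the right action: the character is the trace on the
    whole group algebra of x |-> (c / kappa) x s. *)
Lemma mxtrace_cyclic_submod s : kappa != 0 ->
  \tr (submod_repr (cyclic_mx_module rG (gvec c)) s)
    = kappa^-1 * \sum_g c (g * s^-1 * g^-1)%g.
Proof.
move=> k0; rewrite /submod_repr /= /submod_mx.
have UP := cyclic_gvec c.
rewrite (@mxtrace_in_submod _ _ _ (kappa^-1 *: gmulmx c)).
- rewrite -scalemxAl mxtraceZ; congr (_ * _).
  rewrite /mxtrace [RHS](reindex_onto enum_val idx) /=; last first.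
    by move=> g _; rewrite /idx gring_indexK ?inE.
  under [RHS]eq_bigl => k do rewrite /idx gring_valK eqxx.
  apply: eq_bigr => i _.
  transitivity (row i (gmulmx c *m rG s) 0 i); first by rewrite [RHS]mxE.
  rewrite row_mul row_gmulmx -mulmxA -repr_mxM ?inE // gvec_mul.
  by rewrite invMg mulgA.
- apply: eqmx_trans UP _; apply: eqmx_sym; apply: eqmx_scale.
  by rewrite invr_eq0.
- rewrite -scalemxAl -scalemxAr gmulmx_conv.
  suff -> : gmulmx (gconv c c) = kappa *: gmulmx c by rewrite scalerK.
  by apply/matrixP=> i j; rewrite !mxE cc.
- by have /mxmoduleP := cyclic_mx_module rG (gvec c); apply; rewrite inE.
Qed.

End GroupAlgebra.

(** * The Young symmetrizer of a hook *)

Section Hook.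

Variables (n k : nat).
Hypothesis hk : (1 <= k <= n.+1)%N.
Notation hk_shape := (hook n.+1 k).
Notation RS := (row_stab n.+1 hk_shape).
Notation CS := (col_stab n.+1 hk_shape).

Lemma find_scanl_ones m r :
  (m < r)%N -> find (pred1 0%N) (scanl subn m.+1 (nseq r 1%N)) = m.
Proof.
elim: r m => [|r IHr] [|m] //= mr; rewrite subn1 //=.
by rewrite IHr.
Qed.

Lemma reshape_index_hook (i : 'I_n.+1) : reshape_index hk_shape i = (i.+1 - k)%N.
Proof.
have := ltn_ord i; rewrite /reshape_index /hook /=.
have [ik|ki] := ltnP i k; first by rewrite subn_eq0 ik; lia.
move=> iN; have -> : (i.+1 - k == 0)%N = false by lia.
rewrite subSn // find_scanl_ones; lia.
Qed.

Lemma reshape_offset_hook (i : 'I_n.+1) :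
  reshape_offset hk_shape i = if (i < k)%N then i : nat else 0%N.
Proof.
have := ltn_ord i; rewrite /reshape_offset reshape_index_hook /hook.
move=> iN; have [ik|ki] := ltnP i k.
  by rewrite (eqP (_ : i.+1 - k == 0)%N) ?subn_eq0 ?subn0.
by rewrite subSn //= take_nseq ?leq_sub2r 1?ltnW // sumn_nseq; lia.
Qed.

(** The cells of the first column are 0 and those numbered from k on; cell 0 is the
    corner, which lies on both arms of the hook. *)
Definition in_col (i : nat) := ~~ (0 < i < k)%N.

(** The other rows are single cells, so the row stabilizer only moves cells of the
    first row. *)
Lemma row_stabP (p : 'S_n.+1) :
  reflect (forall i : 'I_n.+1, (k <= i)%N -> p i = i) (p \in RS).
Proof.
rewrite inE; apply: (iffP forallP) => [pP i ki | pP i].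
  by have := pP i; rewrite !reshape_index_hook => /eqP pi; apply: val_inj => /=; lia.
rewrite !reshape_index_hook; apply/eqP.
have [ki|ik] := leqP k i; first by rewrite pP.
have [kpi|] := leqP k (p i); last by lia.
by have /perm_inj pi := pP _ kpi; rewrite pi in kpi; lia.
Qed.

Lemma col_stabP (q : 'S_n.+1) :
  reflect (forall i : 'I_n.+1, ~~ in_col i -> q i = i) (q \in CS).
Proof.
rewrite inE /in_col; apply: (iffP forallP) => [qP i ki | qP i].
  have := qP i; rewrite !reshape_offset_hook => /eqP qi; apply: val_inj => /=.
  move: qi; case/negPn/andP: ki => i0 ik; rewrite ik.
  by case: (ltnP (q i) k); lia.
rewrite !reshape_offset_hook; apply/eqP.
have [ci|ik] := boolP (0 < i < k)%N; first by rewrite qP ?negbK.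
have [cqi|] := boolP (0 < q i < k)%N; last first.
  by move: ik; case: (ltnP i k); case: (ltnP (q i) k); lia.
have /perm_inj qi := qP _ (introT negPn cqi); rewrite qi in cqi; lia.
Qed.

Lemma row_stab_tperm (a b : 'I_n.+1) : (a < k)%N -> (b < k)%N -> tperm a b \in RS.
Proof.
by move=> ak bk; apply/row_stabP=> i ki; rewrite tpermD //; apply/eqP=> ei; subst i; lia.
Qed.

Lemma col_stab_tperm (a b : 'I_n.+1) : in_col a -> in_col b -> tperm a b \in CS.
Proof.
move=> ak bk; apply/col_stabP=> i ki; rewrite tpermD //; apply/eqP=> ei; subst i.
  by rewrite ak in ki.
by rewrite bk in ki.
Qed.

Lemma row_stabM p q : p \in RS -> q \in RS -> (p * q)%g \in RS.
Proof. by move=> /row_stabP p1 /row_stabP q1; apply/row_stabP=> i ki; rewrite permM p1 ?q1. Qed.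

Lemma row_stabV p : p \in RS -> (p^-1)%g \in RS.
Proof. by move=> /row_stabP p1; apply/row_stabP=> i ki; rewrite -{1}(p1 i) ?permK. Qed.

Lemma col_stabM p q : p \in CS -> q \in CS -> (p * q)%g \in CS.
Proof. by move=> /col_stabP p1 /col_stabP q1; apply/col_stabP=> i ki; rewrite permM p1 ?q1. Qed.

Lemma col_stabV p : p \in CS -> (p^-1)%g \in CS.
Proof. by move=> /col_stabP p1; apply/col_stabP=> i ki; rewrite -{1}(p1 i) ?permK. Qed.

Lemma row_stab1 : 1%g \in RS. Proof. by apply/row_stabP=> i _; rewrite perm1. Qed.
Lemma col_stab1 : 1%g \in CS. Proof. by apply/col_stabP=> i _; rewrite perm1. Qed.

Lemma row_col_stabI p : p \in RS -> p \in CS -> p = 1%g.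
Proof.
move=> /row_stabP p1 /col_stabP p2.
have fixp i : i != ord0 -> p i = i.
  move=> i0; have [/p1 //|ik] := leqP k i; apply: p2.
  by rewrite /in_col negbK ik andbT lt0n.
apply/permP=> i; rewrite perm1; have [->|/fixp //] := eqVneq i ord0.
have [->//|p0] := eqVneq (p ord0) ord0.
by have /perm_inj p0' := fixp _ p0; rewrite p0' eqxx in p0.
Qed.

(** The combinatorial half of von Neumann's lemma: if s never sends two cells of
    the first row into the first column, it factors as a row permutation followed
    by a column permutation. *)
Lemma young_factor (s : 'S_n.+1) :
    (forall a b : 'I_n.+1, (a < k)%N -> (b < k)%N -> in_col (s a) -> in_col (s b) -> a = b) ->
  exists2 p, p \in RS & exists2 q, q \in CS & s = (p * q)%g.
Proof.
move=> sP.
(* At most one row cell is sent into the column; sending it to the corner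
   instead, and keeping all other images, gives a permutation p of the row. *)
pose f (i : 'I_n.+1) := if (i < k)%N then if in_col (s i) then ord0 else s i else i.
have f_lt (i : 'I_n.+1) : (i < k)%N -> (f i < k)%N.
  move=> ik; rewrite /f ik; case: ifP => [_|]; first by case/andP: hk.
  by rewrite /in_col => /negbFE/andP[].
have f_ge (i : 'I_n.+1) : (k <= i)%N -> f i = i by move=> ki; rewrite /f ltnNge ki.
have f_inj : injective f.
  move=> i j; have [ik|ki] := ltnP i k; have [jk|kj] := ltnP j k.
  - rewrite /f ik jk; case: ifP => si; case: ifP => sj; first by move=> _; apply: sP.
    + by move=> s0; rewrite -s0 in sj.
    + by move=> s0; rewrite s0 in si.
    + exact: perm_inj.
  - by move=> fij; have := f_lt _ ik; rewrite fij f_ge // ltnNge kj.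
  - by move=> fij; have := f_lt _ jk; rewrite -fij f_ge // ltnNge ki.
  - by rewrite !f_ge.
pose p := perm f_inj; have pE i : p i = f i by rewrite permE.
exists p; first by apply/row_stabP=> i ki; rewrite pE f_ge.
exists (p^-1 * s)%g; last by rewrite mulKVg.
apply/col_stabP=> j; rewrite /in_col negbK => /andP[j0 jk]; rewrite permM.
have : p ((p^-1)%g j) = j by rewrite permKV.
rewrite pE /f; case: ltnP => [_|ki ij]; last by rewrite ij in ki; lia.
by case: ifP => // _ j00; rewrite -j00 in j0.
Qed.

Variable F : numFieldType.
Implicit Types (phi : 'S_n.+1 -> F).

(** The relations satisfied by the Young symmetrizer, which characterize it up to a
    scalar. *)
Definition young_equivariant phi := forall p s q, p \in RS -> q \in CS ->
  phi (p * s * q)%g = (-1) ^+ q * phi s.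

(** Here a transposition of the row is carried by s to a transposition of the
    column, so that the two relations give phi(s) = - phi(s). *)
Lemma young_equivariant_eq0 phi (s : 'S_n.+1) (a b : 'I_n.+1) :
    young_equivariant phi -> a != b -> (a < k)%N -> (b < k)%N ->
  in_col (s a) -> in_col (s b) -> phi s = 0.
Proof.
move=> phiE ab ak bk sa sb; apply/eqP; rewrite -eqNr; apply/eqP.
have := phiE (tperm a b) s (tperm (s a) (s b)) (row_stab_tperm ak bk) (col_stab_tperm sa sb).
rewrite odd_tperm (inj_eq perm_inj) ab expr1 mulN1r => <-; congr phi.
by rewrite -tpermJ /conjg !mulgA mulgK tperm2 mul1g.
Qed.

Lemma young_equivariant_scalar phi psi : young_equivariant phi ->
  young_equivariant psi -> psi 1%g = 1 -> forall s, phi s = phi 1%g * psi s.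
Proof.
move=> phiE psiE psi1 s.
have [/existsP[a /existsP[b /and5P[ab ak bk sa sb]]]|sP] := boolP
  [exists a : 'I_n.+1, exists b : 'I_n.+1,
     [&& a != b, (a < k)%N, (b < k)%N, in_col (s a) & in_col (s b)]].
  by rewrite !(@young_equivariant_eq0 _ s a b) ?mulr0.
have [|p pR [q qC ->]] := @young_factor s.
  move=> a b ak bk sa sb; apply/eqP/contraT => ab; case/negP: sP.
  by apply/existsP; exists a; apply/existsP; exists b; apply/and5P.
rewrite -(mulg1 p) phiE // psiE // psi1 mulr1 mulrC //.
Qed.

Definition young_coef (s : 'S_n.+1) : F :=
  \sum_(p in RS) \sum_(q in CS) (-1) ^+ q * (p * q == s)%g%:R.

Lemma young_symmetrizerE :
  young_symmetrizer F n.+1 hk_shape = gvec young_coef.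
Proof.
rewrite /gvec /young_coef /young_symmetrizer.
under [RHS]eq_bigr => s _ do rewrite scaler_suml.
rewrite [RHS]exchange_big /=; apply: eq_bigr => p _.
under [RHS]eq_bigr => s _ do rewrite scaler_suml.
rewrite [RHS]exchange_big /=; apply: eq_bigr => q _.
rewrite (bigD1 (p * q)%g) //= eqxx mulr1 big1 ?addr0 // => s.
by rewrite eq_sym => /negPf->; rewrite mulr0 scale0r.
Qed.

Lemma young_coef_equivariant : young_equivariant young_coef.
Proof.
move=> p0 s q0 p0R q0C; rewrite /young_coef.
rewrite (reindex_inj (mulgI p0)) /= mulr_sumr.
apply: eq_big => [p|p pR].
  apply/idP/idP => [pR|]; last exact: row_stabM.
  by rewrite -(mulKg p0 p) row_stabM // row_stabV.
rewrite (reindex_inj (mulIg q0)) /= mulr_sumr.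
apply: eq_big => [q|q qC].
  apply/idP/idP => [qR|qC]; last exact: col_stabM.
  by rewrite -(mulgK q0 q) col_stabM // col_stabV.
rewrite odd_permM addbC signr_addb -mulrA; congr (_ * (_ * _%:R)).
by rewrite !mulgA (inj_eq (mulIg _)) -!mulgA (inj_eq (mulgI _)).
Qed.

Lemma young_coef1 : young_coef 1%g = 1.
Proof.
rewrite /young_coef (bigD1 1%g) ?row_stab1 //= (bigD1 1%g) ?col_stab1 //=.
rewrite mulg1 eqxx odd_perm1 mulr1 expr0 !big1 ?addr0 // => [p /andP[pR p1]|q /andP[qC q1]].
  rewrite big1 // => q qC; case: eqP => [|_]; last by rewrite mulr0.
  move/mulg1_eq => pq.
  case/eqP: p1; apply/eqP; rewrite -(inj_eq invg_inj) invg1; apply/eqP.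
  by apply: row_col_stabI; rewrite ?row_stabV // pq.
by rewrite mul1g (negPf q1) mulr0.
Qed.

(** The square of the symmetrizer is equivariant, hence a multiple of the
    symmetrizer. *)
Lemma gconv_young_coef s :
  gconv young_coef young_coef s = gconv young_coef young_coef 1%g * young_coef s.
Proof.
apply: (young_equivariant_scalar _ young_coef_equivariant young_coef1).
move=> p {}s q pR qC.
rewrite /gconv mulr_sumr (reindex_inj (mulIg q)) /=; apply: eq_bigr => h _.
have -> : (p * s * q * (h * q)^-1 = p * (s * h^-1) * 1)%g.
  by rewrite invMg mulg1 !mulgA mulgK.
rewrite -[(h * q)%g]mul1g (mulgA 1%g h q) !young_coef_equivariant ?row_stab1 ?col_stab1 //.
by rewrite odd_perm1 expr0 mul1r mulrCA.
Qed.

End Hook.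

(** * Averages over the symmetric group *)

Lemma perm_map_uniq (T : finType) (s t : seq T) :
  uniq s -> uniq t -> size s = size t -> exists g : {perm T}, map g s = t.
Proof.
move=> us ut st; have sT : (size s <= #|T|)%N by rewrite -(card_uniqP us) max_card.
have tr := ntransitive_weak sT (Sym_trans T).
have sD : in_tuple s \in (size s).-dtuple([set: T]).
  by rewrite inE us; apply/subsetP=> x; rewrite inE.
have tsz : size t == size s by rewrite st.
have tD : Tuple tsz \in (size s).-dtuple([set: T]).
  by rewrite inE ut; apply/subsetP=> x; rewrite inE.
have := tD; rewrite -(atransP tr _ sD) => /imsetP[g _ /(congr1 val) tg].
by exists g; rewrite [t]tg; apply: eq_map => x.
Qed.

(** The symmetric group is transitive on tuples of distinct points, so averaging
    over the group is averaging over such tuples. *)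
Lemma sum_perm_tuple (R : pzRingType) (T : finType) m (phi : m.-tuple T -> R) (t : m.-tuple T) :
    uniq t ->
  #|[pred u : m.-tuple T | uniq u]|%:R * (\sum_(g : {perm T}) phi (map_tuple g t))
    = #|{perm T}|%:R * \sum_(u : m.-tuple T | uniq u) phi u.
Proof.
move=> ut.
have map_inj (g : {perm T}) : injective (@map_tuple m _ _ g).
  by move=> u v /(congr1 val) /(inj_map perm_inj) /val_inj.
transitivity (\sum_(u : m.-tuple T | uniq u) \sum_(g : {perm T}) phi (map_tuple g u)).
  rewrite mulr_natl -sumr_const; apply: eq_bigr => u uu.
  have [|g gt] := @perm_map_uniq _ t u ut uu; first by rewrite !size_tuple.
  rewrite (reindex_inj (mulgI g)) /=; apply: eq_bigr => h _; congr phi.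
  apply: val_inj; change (map (g * h)%g t = map h u).
  by rewrite -gt -map_comp; apply: eq_map => x; rewrite /= permM.
rewrite exchange_big /= mulr_natl -sumr_const; apply: eq_bigr => g _.
rewrite [RHS](reindex_inj (map_inj g)) /=; apply: eq_bigl => u.
by rewrite map_inj_uniq //; apply: perm_inj.
Qed.

Lemma big_tuple_cons (R : nmodType) (T : finType) m (phi : m.+1.-tuple T -> R) :
  \sum_t phi t = \sum_x \sum_(t : m.-tuple T) phi [tuple of x :: t].
Proof.
rewrite pair_bigA /= (reindex (fun p : T * m.-tuple T => [tuple of p.1 :: p.2])) //=.
exists (fun t => (thead t, [tuple of behead t])) => [[x t] _|t _] /=.
  by congr pair; apply: val_inj.
by rewrite -tuple_eta.
Qed.

Lemma big_tuple0 (R : nmodType) (T : finType) (phi : 0.-tuple T -> R) :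
  \sum_t phi t = phi [tuple].
Proof.
by rewrite (bigD1 [tuple]) //= big1 ?addr0 // => t /eqP[]; rewrite tuple0.
Qed.

Section PairSums.

Variables (F : numFieldType) (T : finType).
Implicit Types H : T -> T -> F.

(** For the adjacency matrix of a graph this is the number of ordered edges, and
    [two_pair_sum] below is the number of ordered pairs of disjoint ordered edges. *)
Definition pair_sum H := \sum_(t : 2.-tuple T | uniq t) H (tnth t 0) (tnth t 1).

Definition two_pair_sum H := \sum_(t : 4.-tuple T | uniq t)
  H (tnth t 0) (tnth t 1) * H (tnth t 2) (tnth t 3).

Lemma pair_sumE H : (forall i, H i i = 0) -> pair_sum H = \sum_i \sum_j H i j.
Proof.
move=> H0; rewrite /pair_sum big_mkcond /=.
rewrite big_tuple_cons; apply: eq_bigr => a _.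
rewrite big_tuple_cons; apply: eq_bigr => b _.
rewrite big_tuple0 /= inE andbT !(tnth_nth a) /=.
by case: eqVneq => [->|].
Qed.

(** Inclusion-exclusion over the coincidences between the pairs {a,b} and {c,e}:
    four ways to share one point, two ways to be equal, and all other coincidences
    fall on the zero diagonal. *)
Lemma two_pair_sumE H : (forall i, H i i = 0) -> (forall i j, H i j = H j i) ->
  two_pair_sum H = (\sum_i \sum_j H i j) ^+ 2 - 4 * \sum_i (\sum_j H i j) ^+ 2
                   + 2 * \sum_i \sum_j H i j ^+ 2.
Proof.
move=> H0 Hs; rewrite /two_pair_sum big_mkcond /=.
pose d (x y : T) : F := (x == y)%:R.
have dsum x (phi : T -> F) : \sum_y d x y * phi y = phi x.
  rewrite (bigD1 x) //= /d eqxx mul1r big1 ?addr0 // => y.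
  by rewrite eq_sym => /negPf->; rewrite mul0r.
transitivity (\sum_a \sum_b \sum_c \sum_e
    (H a b * H c e - d a c * (H a b * H c e) - d a e * (H a b * H c e)
     - d b c * (H a b * H c e) - d b e * (H a b * H c e)
     + d a c * (d b e * (H a b * H c e)) + d a e * (d b c * (H a b * H c e)))).
  rewrite big_tuple_cons; apply: eq_bigr => a _.
  rewrite big_tuple_cons; apply: eq_bigr => b _.
  rewrite big_tuple_cons; apply: eq_bigr => c _.
  rewrite big_tuple_cons; apply: eq_bigr => e _.
  rewrite big_tuple0 /= !inE !(tnth_nth a) /= andbT /d !negb_or.
  have [->|ab] := eqVneq a b; first by rewrite !H0 /=; ring.
  have [->|ce] := eqVneq c e; first by rewrite !H0 /= ?andbF; ring.
  have [ac|ac] := eqVneq a c; have [ae|ae] := eqVneq a e;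
  have [bc|bc] := eqVneq b c; have [be|be] := eqVneq b e;
    rewrite /= ?mul0r ?mul1r ?subr0 ?addr0 ?mulr0;
    try (by subst; rewrite eqxx in ab); try (by subst; rewrite eqxx in ce); ring.
pose r a := \sum_b H a b.
transitivity (\sum_a \sum_b (H a b * (\sum_c r c) - H a b * r a - H a b * r a
   - H a b * r b - H a b * r b + H a b ^+ 2 + H a b ^+ 2)).
  apply: eq_bigr => a _; apply: eq_bigr => b _.
  under eq_bigr => c _ do rewrite big_split big_split !sumrB /=.
  rewrite big_split big_split !sumrB /=; congr (_ - _ - _ - _ - _ + _ + _).
  - by rewrite mulr_sumr; apply: eq_bigr => c _; rewrite -mulr_sumr.
  - under eq_bigr => c _ do rewrite -mulr_sumr -mulr_sumr.
    by rewrite dsum.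
  - rewrite exchange_big /=; under eq_bigr => e _ do rewrite -mulr_sumr -mulr_sumr.
    by rewrite dsum /r; congr (_ * _); apply: eq_bigr => c _; rewrite Hs.
  - under eq_bigr => c _ do rewrite -mulr_sumr -mulr_sumr.
    by rewrite dsum.
  - rewrite exchange_big /=; under eq_bigr => e _ do rewrite -mulr_sumr -mulr_sumr.
    by rewrite dsum /r; congr (_ * _); apply: eq_bigr => c _; rewrite Hs.
  - under eq_bigr => c _ do rewrite -mulr_sumr dsum.
    by rewrite dsum expr2.
  - under eq_bigr => c _.
      under eq_bigr => e _ do rewrite mulrCA.
      rewrite -mulr_sumr dsum; over.
    by rewrite dsum Hs expr2 [H b a]Hs.
have E1 : \sum_a \sum_b H a b * r a = \sum_a r a ^+ 2.
  by apply: eq_bigr => a _; rewrite -mulr_suml expr2.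
have E2 : \sum_a \sum_b H a b * r b = \sum_a r a ^+ 2.
  rewrite -E1 exchange_big /=; apply: eq_bigr => a _; apply: eq_bigr => b _.
  by rewrite Hs.
set S := \sum_c r c; under [LHS]eq_bigr => a _ do rewrite !big_split !sumrN /=.
rewrite !big_split !sumrN /= E1 E2.
have -> : \sum_a \sum_b H a b * S = S ^+ 2.
  by under eq_bigr => a _ do rewrite -mulr_suml; rewrite -mulr_suml expr2.
rewrite /S /r; ring.
Qed.

End PairSums.

(** * Values of the hook characters *)

Section HookCharacter.

Variables (n k : nat).
Hypothesis hk : (1 <= k <= n.+1)%N.
Variable F : numFieldType.
Notation la := (hook n.+1 k).
Notation RS := (row_stab n.+1 la).
Notation CS := (col_stab n.+1 la).
Notation f := (@young_coef n k F).
Notation chi := (@sym_char F n.+1 la).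
Implicit Types (s g : 'S_n.+1).

Let kappa : F := gconv f f 1%g.

Lemma perm_card_neq0 : #|{perm 'I_n.+1}|%:R != 0 :> F.
Proof. by rewrite pnatr_eq0 -lt0n; apply/card_gt0P; exists 1%g. Qed.

Lemma young_kappa_neq0 : kappa != 0.
Proof.
apply: (quasi_idempotent_neq0 (gconv_young_coef hk F)).
  by rewrite young_coef1 ?oner_eq0.
by rewrite cardsT perm_card_neq0.
Qed.

Lemma hook_charE s : chi s = kappa^-1 * \sum_(g : 'S_n.+1) f (s^-1 ^ g)%g.
Proof.
rewrite /sym_char /specht_repr young_symmetrizerE.
rewrite (mxtrace_cyclic_submod (gconv_young_coef hk F)) ?young_kappa_neq0 //.
congr (_ * _); rewrite (reindex_inj invg_inj) /=; apply: eq_bigr => g _.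
by rewrite invgK conjgE mulgA.
Qed.

Lemma hook_charJ s g : chi (s ^ g)%g = chi s.
Proof.
rewrite !hook_charE [in RHS](reindex_inj (mulgI g)) /=; congr (_ * _).
by apply: eq_bigr => h _; rewrite -conjVg -conjgM.
Qed.

(** In the sum giving chi(1) every term is the coefficient of 1 in the symmetrizer,
    which is 1. *)
Lemma hook_char1_neq0 : chi 1%g != 0.
Proof.
rewrite hook_charE mulf_neq0 ?invr_neq0 ?young_kappa_neq0 //.
under eq_bigr => g _ do rewrite invg1 conj1g young_coef1 //.
by rewrite sumr_const perm_card_neq0.
Qed.

(** Unless the hook is a single row, the column stabilizer contains a transposition,
    which changes the sign of the sum of the coefficients of the symmetrizer: chi
    does not contain the trivial character. *)
Lemma sum_hook_char : (k <= n)%N -> \sum_s chi s = 0.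
Proof.
move=> kn; have fs : \sum_s f s = 0.
  apply/eqP; rewrite -eqNr; apply/eqP.
  pose q := tperm (ord0 : 'I_n.+1) (inord k).
  have kv : (inord k : 'I_n.+1) = k :> nat by rewrite inordK.
  rewrite [in RHS](reindex_inj (mulIg q)) /= -sumrN; apply: eq_bigr => s _.
  have qC : q \in CS by apply: col_stab_tperm => //; rewrite /in_col ?kv; lia.
  rewrite -(mul1g s) young_coef_equivariant ?row_stab1 // mul1g odd_tperm.
  by rewrite -val_eqE /= kv eq_sym -lt0n; case/andP: hk => -> _; rewrite expr1 mulN1r.
under eq_bigr => s _ do rewrite hook_charE.
rewrite -mulr_sumr exchange_big /= big1 ?mulr0 // => g _; rewrite -[RHS]fs.
rewrite [RHS](reindex_inj (h := fun s => (s^-1 ^ g)%g)) // => s t.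
by move/conjg_inj/invg_inj.
Qed.

(** Up to the diagonal, this is the coefficient of the transposition of a and b in
    the symmetrizer: 1 along the row, -1 along the column, 0 otherwise. *)
Definition hook_pair (a b : 'I_n.+1) : F :=
  if a == b then 0 else ((a < k) && (b < k))%N%:R - (in_col k a && in_col k b)%:R.

Definition same_arm (a b : nat) := (a < k)%N && (b < k)%N || in_col k a && in_col k b.

Lemma same_armC a b : same_arm a b = same_arm b a.
Proof. by rewrite /same_arm andbC [in_col k a && _]andbC. Qed.

Lemma different_arms a b : ~~ same_arm a b -> ~~ ((a < k)%N && ~~ (b < k)%N) ->
  (b < k)%N && ~~ (a < k)%N.
Proof. rewrite /same_arm /in_col; lia. Qed.

Lemma young_coef_tperm (a b : 'I_n.+1) s : a != b ->
    same_arm a b ->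
    s a = a -> s b = b ->
  f (tperm a b * s)%g = hook_pair a b * f s.
Proof.
move=> ab abP sa sb; rewrite /hook_pair (negPf ab).
have [/andP[ak bk]|abR] := boolP ((a < k) && (b < k))%N.
  rewrite -[(tperm a b * s)%g]mulg1 young_coef_equivariant ?col_stab1 ?row_stab_tperm //.
  have -> : in_col k a && in_col k b = false.
    move: ab; rewrite /in_col -val_eqE /=; lia.
  by rewrite odd_perm1 expr0 subr0.
have := abP; rewrite /same_arm (negPf abR) /= => abC; rewrite abC; case/andP: abC => aC bC.
have -> : (tperm a b * s = 1 * s * tperm a b)%g.
  by rewrite mul1g -{2}sa -{2}sb -tpermJ /conjg !mulgA mulgV mul1g.
rewrite young_coef_equivariant ?row_stab1 ?col_stab_tperm // odd_tperm ab expr1.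
by rewrite sub0r.
Qed.

(** When a and b are on different arms, say a on the row and b below, the
    transposition sends the row cells a and 0 to b and 0, both in the column. *)
Lemma young_coef_tperm1 (a b : 'I_n.+1) : a != b -> f (tperm a b) = hook_pair a b.
Proof.
move=> ab; have [abP|abN] := boolP (same_arm a b).
  by rewrite -[tperm a b]mulg1 young_coef_tperm ?perm1 // young_coef1 // mulr1.
rewrite /hook_pair (negPf ab); move: (abN); rewrite /same_arm negb_or => /andP[/negPf-> /negPf->].
rewrite subr0; have fE := young_coef_equivariant hk F.
wlog ak : a b ab abN / (a < k)%N && ~~ (b < k)%N.
  move=> IH; have [ak|ka] := boolP ((a < k)%N && ~~ (b < k)%N); first exact: IH.
  rewrite tpermC; apply: IH; rewrite 1?eq_sym 1?same_armC //.
  exact: different_arms.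
case/andP: ak => ak kb.
have a0 : a != ord0.
  by apply: contraNneq abN => ->; move: kb; rewrite /same_arm /in_col /=; clear; lia.
have b0 : b != ord0 by apply: contraNneq kb => ->; case/andP: hk.
apply: (@young_equivariant_eq0 _ _ hk _ _ _ a ord0 fE) => //; first by case/andP: hk.
  by rewrite tpermL /in_col; move: kb; clear; lia.
by rewrite tpermD.
Qed.

(** If both transpositions join different arms, their product sends two row cells
    into the column, so that its coefficient is 0, like both factors. *)
Lemma young_coef_tperm2 (a b c e : 'I_n.+1) : uniq [:: a; b; c; e] ->
  f (tperm a b * tperm c e)%g = hook_pair a b * hook_pair c e.
Proof.
move=> u; have ab : a != b by move: u; rewrite /= !inE; case: eqP.
have ce : c != e by move: u; rewrite /= !inE; case: (c =P e) => //; rewrite !andbF.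
have [ac ae bc be] : [/\ a != c, a != e, b != c & b != e].
  by move: u; rewrite /= !inE !negb_or andbT => /and3P[/and3P[_ -> ->] /andP[-> ->] _].
have [ca ea cb eb] : [/\ c != a, e != a, c != b & e != b] by split; rewrite eq_sym.
have [abP|abN] := boolP (same_arm a b).
  rewrite young_coef_tperm ?tpermD // young_coef_tperm1 //.
have [ceP|ceN] := boolP (same_arm c e).
  have -> : (tperm a b * tperm c e = tperm c e * tperm a b)%g.
    have := tpermJ c e (tperm a b); rewrite !tpermD // => {1}<-.
    by rewrite conjgE tpermV !mulgA tperm2 mul1g.
  by rewrite young_coef_tperm ?tpermD // young_coef_tperm1 // mulrC.
have -> : hook_pair a b = 0.
  rewrite /hook_pair (negPf ab); move: (abN); rewrite /same_arm negb_or.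
  by move=> /andP[/negPf-> /negPf->]; rewrite subr0.
rewrite mul0r; have fE := young_coef_equivariant hk F.
wlog ak : a b ab abN ac ae bc be ca ea cb eb {u} / (a < k)%N && ~~ (b < k)%N.
  move=> IH; have [ak|ka] := boolP ((a < k)%N && ~~ (b < k)%N); first exact: IH.
  rewrite (tpermC a); apply: IH; rewrite // 1?eq_sym 1?same_armC //.
  exact: different_arms.
wlog ck : c e ce ceN ac ae bc be ca ea cb eb / (c < k)%N && ~~ (e < k)%N.
  move=> IH; have [ck|kc] := boolP ((c < k)%N && ~~ (e < k)%N); first exact: IH.
  rewrite (tpermC c); apply: IH; rewrite // 1?eq_sym 1?same_armC //.
  exact: different_arms.
case/andP: ak => ak kb; case/andP: ck => ck ke.
apply: (@young_equivariant_eq0 _ _ hk _ _ _ a c fE) => //.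
  by rewrite permM tpermL tpermD // /in_col; move: kb; clear; lia.
by rewrite permM (tpermD ac bc) tpermL /in_col; move: ke; clear; lia.
Qed.

Lemma card_uniq_tuple_neq0 m : (m <= n.+1)%N ->
  #|[pred u : m.-tuple 'I_n.+1 | uniq u]|%:R != 0 :> F.
Proof.
move=> mn; rewrite pnatr_eq0 -lt0n; apply/card_gt0P.
exists [tuple widen_ord mn i | i < m].
by rewrite inE /= map_inj_uniq ?enum_uniq // => i j /(congr1 val) /= /val_inj.
Qed.

(** By averaging, chi at a transposition is a nonzero multiple of the sum of the
    coefficients over all the transpositions. *)
Lemma hook_char_tperm_neq0 (a b : 'I_n.+1) : a != b ->
  (chi (tperm a b) != 0) = (pair_sum hook_pair != 0).
Proof.
move=> ab; rewrite hook_charE mulf_eq0 invr_eq0 (negPf young_kappa_neq0) /=.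
have n2 : (2 <= n.+1)%N.
  by move: ab (ltn_ord a) (ltn_ord b); rewrite -val_eqE /=; lia.
have := @sum_perm_tuple F 'I_n.+1 2 (fun t => hook_pair (tnth t 0) (tnth t 1)) [tuple a; b].
rewrite /= inE ab => /(_ isT) /(congr1 (fun x => x == 0)).
rewrite !mulf_eq0 (negPf (card_uniq_tuple_neq0 n2)) (negPf perm_card_neq0) /= => <-.
congr (~~ (_ == 0)); apply: eq_bigr => g _.
by rewrite tpermV tpermJ young_coef_tperm1 ?(inj_eq perm_inj).
Qed.

Lemma hook_char_tperm2_neq0 (a b c e : 'I_n.+1) : uniq [:: a; b; c; e] ->
  (chi (tperm a b * tperm c e)%g != 0) = (two_pair_sum hook_pair != 0).
Proof.
move=> u; rewrite hook_charE mulf_eq0 invr_eq0 (negPf young_kappa_neq0) /=.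
have n4 : (4 <= n.+1)%N.
  have : (size [:: a; b; c; e] <= #|'I_n.+1|)%N by rewrite -(card_uniqP u) max_card.
  by rewrite card_ord.
have := @sum_perm_tuple F 'I_n.+1 4
  (fun t => hook_pair (tnth t 0) (tnth t 1) * hook_pair (tnth t 2) (tnth t 3)) [tuple a; b; c; e].
move=> /(_ u) /(congr1 (fun x => x == 0)).
rewrite !mulf_eq0 (negPf (card_uniq_tuple_neq0 n4)) (negPf perm_card_neq0) /= => <-.
congr (~~ (_ == 0)); apply: eq_bigr => g _.
rewrite invMg !tpermV conjMg.
rewrite (tpermJ c e g) (tpermJ a b g).
rewrite young_coef_tperm2; first by rewrite mulrC.
change (uniq (map g [:: c; e; a; b])).
rewrite (map_inj_uniq perm_inj).
by rewrite -(rot_uniq 2).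
Qed.

Lemma hook_pairC a b : hook_pair a b = hook_pair b a.
Proof. by rewrite /hook_pair eq_sym andbC [in_col _ _ && _]andbC. Qed.

Lemma hook_pair_diag a : hook_pair a a = 0.
Proof. by rewrite /hook_pair eqxx. Qed.

Lemma sum_row_indicator : \sum_(i < n.+1) (i < k)%N%:R = k%:R :> F.
Proof.
have [_ kn] := andP hk; transitivity (\sum_(i < k) 1 : F); last by rewrite sumr_const card_ord.
rewrite (big_ord_widen _ (fun=> 1) kn) [RHS]big_mkcond /=.
by apply: eq_bigr => i _; case: (i < k)%N.
Qed.

Lemma sum_col_indicator : \sum_(i < n.+1) (in_col k i)%:R = (n.+1 - k).+1%:R :> F.
Proof.
have [k0 kn] := andP hk.
transitivity (\sum_(i < n.+1) (1 - (i < k)%N%:R + (i == ord0)%:R) : F).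
  apply: eq_bigr => i _; rewrite /in_col -val_eqE /= lt0n.
  case: (eqVneq (i : nat) 0%N) => [->|i0] /=; first by rewrite k0 subrr add0r.
  by case: (i < k)%N; rewrite addr0 ?subrr ?subr0.
rewrite big_split sumrB /= sum_row_indicator sumr_const card_ord -natrB //.
by rewrite (bigD1 ord0) //= big1 ?addr0 ?natr1 // => i /negPf->.
Qed.

Lemma hook_pair_row a : \sum_b hook_pair a b =
  (a < k)%N%:R * (k%:R - 1) - (in_col k a)%:R * (n.+1 - k)%:R.
Proof.
transitivity (\sum_(b < n.+1) ((a < k)%N%:R * (b < k)%N%:R - (in_col k a)%:R * (in_col k b)%:R
    - (b == a)%:R * ((a < k)%N%:R - (in_col k a)%:R)) : F).
  apply: eq_bigr => b _; rewrite /hook_pair eq_sym -!natrM !mulnb.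
  by case: eqVneq => [->|_]; rewrite ?mul0r ?subr0 // !andbb mul1r subrr.
rewrite !sumrB -!mulr_sumr sum_row_indicator sum_col_indicator -mulr_suml.
rewrite (bigD1 a) //= big1 => [|i /negPf->//]; rewrite eqxx mulr1n -(natr1 (n.+1 - k)%N); ring.
Qed.

Lemma hook_pair_row_sqr a : \sum_b hook_pair a b ^+ 2 =
  (a < k)%N%:R * (k%:R - 1) + (in_col k a)%:R * (n.+1 - k)%:R.
Proof.
transitivity (\sum_(b < n.+1) ((a < k)%N%:R * (b < k)%N%:R + (in_col k a)%:R * (in_col k b)%:R
    - (b == a)%:R * ((a < k)%N%:R + (in_col k a)%:R)) : F).
  apply: eq_bigr => b _; rewrite /hook_pair eq_sym -!natrM !mulnb.
  case: eqVneq => [->|ba]; first by rewrite expr0n !andbb mul1r subrr.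
  have : ~~ ((a < k)%N && (b < k)%N && (in_col k a && in_col k b)).
    by move: ba; rewrite -val_eqE /in_col /=; lia.
  by case: (_ && (b < k)%N); case: (_ && in_col _ _) => //= _; ring.
rewrite sumrB big_split /= -!mulr_sumr sum_row_indicator sum_col_indicator -mulr_suml.
rewrite (bigD1 a) //= big1 => [|i /negPf->//]; rewrite eqxx mulr1n -(natr1 (n.+1 - k)%N); ring.
Qed.

Lemma pair_sum_hook : pair_sum hook_pair =
  k%:R * (k%:R - 1) - (n.+1 - k).+1%:R * (n.+1 - k)%:R.
Proof.
rewrite pair_sumE; last exact: hook_pair_diag.
under eq_bigr => a _ do rewrite hook_pair_row.
by rewrite sumrB -!mulr_suml sum_row_indicator sum_col_indicator.
Qed.

Lemma natr_row_pred : k%:R - 1 = k.-1%:R :> F.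
Proof. by case/andP: hk => k0 _; rewrite -[in LHS](prednK k0) -natr1 addrK. Qed.

(** The sum is k (k - 1) - (m + 1) m with m = N - k, so it vanishes only for
    m = k - 1. *)
Lemma pair_sum_hook_neq0 : n.+1 != k.*2.-1 -> pair_sum hook_pair != 0.
Proof.
move=> nk; rewrite pair_sum_hook natr_row_pred -!natrM subr_eq0 eqr_nat; apply/eqP.
case/andP: hk => k0 kn.
have : (n.+1 - k)%N != k.-1 by lia.
rewrite -[X in (X * _)%N](prednK k0).
move: (n.+1 - k)%N k.-1 => c m; rewrite neq_ltn => /orP[] ?; nia.
Qed.

(** With r = k - 1 = N - k the sum of the weights is 0, every cell but the corner
    has row sum r or -r, and the sum of squares is 2 r (r + 1); the formula for
    [two_pair_sum] gives - 4 r (2 r + 1) (r - 1), which vanishes only for r <= 1. *)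
Lemma two_pair_sum_hook_neq0 : n.+1 = k.*2.-1 -> (3 <= k)%N -> two_pair_sum hook_pair != 0.
Proof.
move=> nk k3; rewrite two_pair_sumE; [|exact: hook_pair_diag|exact: hook_pairC].
have kr := natr_row_pred; set r := (k.-1) in kr *.
have ck : (n.+1 - k)%N = r by rewrite /r; lia.
have rk : k = r.+1 by rewrite /r; lia.
rewrite -pair_sumE; last exact: hook_pair_diag.
have -> : pair_sum hook_pair = 0.
  by rewrite pair_sum_hook kr ck -rk subrr.
have -> : \sum_a (\sum_b hook_pair a b) ^+ 2 = r%:R ^+ 2 * (r%:R *+ 2).
  transitivity (\sum_(a < n.+1) r%:R ^+ 2 * (1 - (a == ord0)%:R) : F).
    apply: eq_bigr => a _; rewrite hook_pair_row kr ck -mulrBl exprMn mulrC.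
    congr (_ * _); rewrite /in_col -val_eqE /= lt0n.
    case: (eqVneq (a : nat) 0%N) => [->|a0] /=.
      by case/andP: hk => -> _; rewrite !subrr expr0n.
    by case: (a < k)%N; rewrite /= ?subr0 ?expr1n // sub0r sqrrN expr1n.
  rewrite -mulr_sumr sumrB sumr_const card_ord (bigD1 ord0) //= big1 => [|i /negPf->//].
  rewrite ?mulr1n addr0 -(natr1 n) addrK -mulrnA; congr (_ * _%:R); lia.
have -> : \sum_a \sum_b hook_pair a b ^+ 2 = (k * r)%:R *+ 2.
  under eq_bigr => a _ do rewrite hook_pair_row_sqr.
  rewrite big_split -!mulr_suml /= sum_row_indicator sum_col_indicator kr ck -rk.
  by rewrite -natrM -mulr2n.
rewrite expr0n /= sub0r rk.
have -> : - (4 * (r%:R ^+ 2 * (r%:R *+ 2))) + 2 * ((r.+1 * r)%:R *+ 2)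
    = - (4 * (r * (2 * r + 1) * (r - 1))%N%:R) :> F.
  by rewrite !natrM natrB ?natrD -?natr1; [ring | rewrite /r; lia].
rewrite oppr_eq0 -natrM pnatr_eq0 !muln_eq0; rewrite /r; clear -k3; lia.
Qed.

End HookCharacter.

(** * Self-conjugate hooks *)

Section SelfConjugateHook.

Variables (n k : nat).
Hypothesis hk : (1 <= k <= n.+1)%N.
Hypothesis nk : n.+1 = k.*2.-1.
Variable F : numFieldType.
Notation la := (hook n.+1 k).
Notation RS := (row_stab n.+1 la).
Notation CS := (col_stab n.+1 la).
Notation f := (@young_coef n k F).
Notation chi := (@sym_char F n.+1 la).

(** The reflection of the self-conjugate hook in its diagonal. *)
Definition flip_cell (i : 'I_n.+1) : 'I_n.+1 :=
  if i == ord0 then ord0 else if (i < k)%N then inord (i + k.-1) else inord (i - k.-1).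

Lemma flip_cell_val (i : 'I_n.+1) : flip_cell i =
  (if i == 0 :> nat then 0 else if i < k then i + k.-1 else i - k.-1)%N :> nat.
Proof.
have iN := ltn_ord i; rewrite /flip_cell -val_eqE /=.
by case: eqVneq => [//|i0]; case: ltnP => ik; rewrite inordK //; lia.
Qed.

Lemma flip_cellK : involutive flip_cell.
Proof.
move=> i; apply: val_inj; rewrite /= !flip_cell_val; have := ltn_ord i.
case: (eqVneq (i : nat) 0%N) => [//|i0]; case: (ltnP i k) => ik iN.
  have -> : (i + k.-1 == 0)%N = false by lia.
  have -> : (i + k.-1 < k)%N = false by lia.
  lia.
have -> : (i - k.-1 == 0)%N = false by lia.
have -> : (i - k.-1 < k)%N by lia.
lia.
Qed.

Lemma flip_cell_col (i : 'I_n.+1) : in_col k (flip_cell i) = (i < k)%N.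
Proof.
have := ltn_ord i; rewrite /in_col flip_cell_val.
case: (eqVneq (i : nat) 0%N) => [i0|i0].
  by rewrite i0 /=; case/andP: hk => ->.
by case: (ltnP i k) => ik iN; lia.
Qed.

Lemma flip_cell_row (i : 'I_n.+1) : (flip_cell i < k)%N = in_col k i.
Proof. by rewrite -flip_cell_col flip_cellK. Qed.

Definition flip_perm := perm (inv_inj flip_cellK).

Lemma flip_permE i : flip_perm i = flip_cell i. Proof. exact: permE. Qed.

Lemma flip_permK : (flip_perm * flip_perm = 1)%g.
Proof. by apply/permP=> i; rewrite permM !flip_permE flip_cellK perm1. Qed.

Lemma flip_permV : (flip_perm^-1)%g = flip_perm.
Proof. exact/mulg1_eq/flip_permK. Qed.

Lemma conj_flipE p i : (p ^ flip_perm)%g i = flip_cell (p (flip_cell i)).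
Proof. by rewrite conjgE flip_permV !permM !flip_permE. Qed.

Lemma row_stab_flip p : ((p ^ flip_perm)%g \in CS) = (p \in RS).
Proof.
apply/(col_stabP hk)/(row_stabP hk) => pP i iP.
  have := pP (flip_cell i); rewrite flip_cell_col -leqNgt conj_flipE flip_cellK.
  by move/(_ iP)/(can_inj flip_cellK).
by rewrite conj_flipE pP ?flip_cellK // leqNgt flip_cell_row.
Qed.

Lemma col_stab_flip p : ((p ^ flip_perm)%g \in RS) = (p \in CS).
Proof.
by rewrite -row_stab_flip -conjgM flip_permK conjg1.
Qed.

(** The reflection exchanges the two stabilizers, hence turns the inverse of p q
    into a product of the same kind, in which the signs of p and q are exchanged. *)
Lemma young_coef_flip s : f (s^-1 ^ flip_perm)%g = (-1) ^+ s * f s.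
Proof.
have inj_flip : injective (fun p : 'S_n.+1 => (p^-1 ^ flip_perm)%g).
  by move=> p q /conjg_inj/invg_inj.
have flipV p : (p^-1 ^ flip_perm = (p ^ flip_perm)^-1)%g by rewrite conjVg.
rewrite /young_coef (reindex_inj inj_flip) /=.
under eq_bigr => q _ do rewrite (reindex_inj inj_flip) /=.
rewrite exchange_big /= mulr_sumr; apply: eq_big => p.
  rewrite flipV -row_stab_flip; apply/idP/idP; last exact: col_stabV.
  by move/(col_stabV hk); rewrite invgK.
move=> _; rewrite mulr_sumr; apply: eq_big => q.
  rewrite flipV -col_stab_flip; apply/idP/idP; last exact: row_stabV.
  by move/(row_stabV hk); rewrite invgK.
move=> _; rewrite -conjMg -invMg (inj_eq inj_flip); case: eqP => [<-|_]; last by rewrite !mulr0.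
by rewrite !mulr1 odd_permJ odd_permV odd_permM signr_addb -mulrA -signr_addb addbb mulr1.
Qed.

(** As s is conjugate to its inverse this means that chi vanishes at odd
    permutations; in this form it directly cancels the sums over odd permutations
    whose weights are invariant under inversion. *)
Lemma hook_charV s : chi (s^-1)%g = (-1) ^+ s * chi s.
Proof.
rewrite !hook_charE // mulrCA invgK; congr (_ * _); rewrite mulr_sumr.
rewrite [LHS](reindex_inj (mulIg flip_perm)) /=; apply: eq_bigr => g _.
have -> : (-1) ^+ s = (-1) ^+ (s^-1 ^ g)%g :> F by rewrite odd_permJ odd_permV.
by rewrite -young_coef_flip -conjVg invgK conjgM.
Qed.

End SelfConjugateHook.

(** * Immanants of xI - A for a matrix A with zero diagonal *)

Section ImmanantalPolynomial.

Variables (F : fieldType) (n : nat) (la : seq nat).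
Implicit Types (s : 'S_n) (A : 'M[F]_n).

Definition moved s := #|[pred i | s i != i]|.

Definition moved_weight A s := \prod_(i | s i != i) - A i (s i).

Lemma moved_le s : (moved s <= n)%N.
Proof. by rewrite -[X in (_ <= X)%N]card_ord max_card. Qed.

(** Since A has a zero diagonal, a permutation picks p at its fixed points and
    entries of -A at the points that it moves. *)
Lemma immanant_shifted A (p : {poly F}) : (forall i, A i i = 0) ->
  immanant la (p%:M - map_mx polyC A)
    = \sum_s (sym_char F la s * moved_weight A s) *: p ^+ (n - moved s).
Proof.
move=> A0; apply: eq_bigr => s _; rewrite -scalerA; congr (_ *: _).
rewrite (bigID (fun i => s i != i)) /= -mul_polyC /moved_weight rmorph_prod.
congr (_ * _).
  by apply: eq_bigr => i si; rewrite !mxE eq_sym (negPf si) sub0r -rmorphN.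
transitivity (\prod_(i | ~~ (s i != i)) p).
  by apply: eq_bigr => i /negPn/eqP->; rewrite !mxE eqxx A0 subr0.
rewrite prodr_const; congr (_ ^+ _).
have := cardC [pred i | s i != i]; rewrite card_ord -/(moved s) => ms.
by rewrite -[X in (X - _)%N]ms addKn.
Qed.

Lemma coef_immanant A j : (forall i, A i i = 0) ->
  (immanant la ('X%:M - map_mx polyC A))`_j
    = \sum_(s : 'S_n | (n - moved s == j)%N) sym_char F la s * moved_weight A s.
Proof.
move=> A0; rewrite immanant_shifted // coef_sum [RHS]big_mkcond /=.
apply: eq_bigr => s _; rewrite coefZ coefXn eq_sym.
by case: eqP; rewrite ?mulr1 ?mulr0.
Qed.

Lemma immanant_comp A (p : {poly F}) : (forall i, A i i = 0) ->
  immanant la (p%:M - map_mx polyC A) = immanant la ('X%:M - map_mx polyC A) \Po p.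
Proof.
move=> A0; rewrite !immanant_shifted // raddf_sum; apply: eq_bigr => s _ /=.
by rewrite comp_polyZ comp_Xn_poly.
Qed.

Lemma moved_weight_scale c A s : moved_weight (c *: A) s = c ^+ moved s * moved_weight A s.
Proof.
rewrite /moved_weight /moved -prodr_const -big_split /=.
by apply: eq_bigr => i _; rewrite mxE mulrN.
Qed.

(** Replacing A by c A multiplies the coefficient of x^j by c^(n-j). *)
Lemma immanant_scale_inj (c : F) A (B : 'M[F]_n) : c != 0 ->
    (forall i, A i i = 0) -> (forall i, B i i = 0) ->
  immanant la ('X%:M - map_mx polyC (c *: A)) = immanant la ('X%:M - map_mx polyC (c *: B))
  <-> immanant la ('X%:M - map_mx polyC A) = immanant la ('X%:M - map_mx polyC B).
Proof.
move=> c0 A0 B0.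
have coefc (M : 'M[F]_n) j : (forall i, M i i = 0) ->
    (immanant la ('X%:M - map_mx polyC (c *: M)))`_j
      = c ^+ (n - j) * (immanant la ('X%:M - map_mx polyC M))`_j.
  move=> M0; rewrite !coef_immanant // => [|i]; last by rewrite mxE M0 mulr0.
  rewrite mulr_sumr; apply: eq_bigr => s /eqP <-.
  by rewrite subKn ?moved_le // moved_weight_scale mulrCA.
split=> /polyP PE; apply/polyP=> j; have := PE j; rewrite (coefc A) // (coefc B) //.
  by move/mulfI; apply; rewrite expf_neq0.
by move=> ->.
Qed.

(** The substitution x |-> x - c is invertible. *)
Lemma immanant_shift_inj (c : F) A (B : 'M[F]_n) :
    (forall i, A i i = 0) -> (forall i, B i i = 0) ->
  immanant la (('X - c%:P)%:M - map_mx polyC A) = immanant la (('X - c%:P)%:M - map_mx polyC B)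
  <-> immanant la ('X%:M - map_mx polyC A) = immanant la ('X%:M - map_mx polyC B).
Proof.
move=> A0 B0; rewrite (immanant_comp ('X - c%:P) A0) (immanant_comp ('X - c%:P) B0).
split=> [/(congr1 (fun p => p \Po ('X + c%:P)))|-> //].
by rewrite -!comp_polyA comp_polyB comp_polyX comp_polyC addrK !comp_polyXr.
Qed.

End ImmanantalPolynomial.

(** * Permutations moving few points *)

Section SupportOfPermutation.

Variable n : nat.
Implicit Types s t : 'S_n.

Lemma moved0 : moved (1%g : 'S_n) = 0%N.
Proof. by apply: eq_card0 => i; rewrite inE /= perm1 eqxx. Qed.

Lemma perm_eq1_moved s : (moved s <= 1)%N -> s = 1%g.
Proof.
move=> s1; apply/permP=> i; rewrite perm1; apply/eqP/contraT=> si.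
have/card_le1_eqP := s1 => /(_ i (s i)); rewrite !inE /= (inj_eq perm_inj) => /(_ si si) /eqP.
by rewrite (negPf si).
Qed.

(** Multiplying s by the transposition of a and s a makes a a fixed point and
    moves no new point. *)
Lemma moved_mul_tperm s : s != 1%g ->
  exists a b s', [/\ a != b, s = (s' * tperm a b)%g & (moved s' < moved s)%N].
Proof.
move=> s1; have [a sa] : exists a, s a != a.
  apply/existsP/contraT; rewrite negb_exists => /forallP sP; case/eqP: s1.
  by apply/permP=> i; rewrite perm1; apply/eqP/negPn/sP.
exists a, (s a), (s * tperm a (s a))%g; rewrite -mulgA tperm2 mulg1 eq_sym.
split=> //; apply: proper_card; apply/properP; split; last first.
  by exists a; rewrite inE //= permM tpermR eqxx.
apply/subsetP=> i; rewrite !inE permM; apply: contra => /eqP si.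
rewrite si tpermD //; apply: contraNneq sa => ai; first by rewrite {1}ai si ai.
by rewrite -(inj_eq (@perm_inj _ s)) ai si -ai.
Qed.

Lemma moved2P s : moved s = 2%N -> exists a b, a != b /\ s = tperm a b.
Proof.
move=> s2; have [|a [b [t [ab sE ts]]]] := @moved_mul_tperm s.
  by apply/eqP=> s1; rewrite s1 moved0 in s2.
exists a, b; split=> //; rewrite sE (@perm_eq1_moved t) ?mul1g //.
by rewrite -ltnS -s2 ts.
Qed.

(** Splitting off two transpositions from an even permutation with four moved points
    leaves an even permutation with at most two moved points, which is 1; the two
    transpositions are disjoint since they cover four points. *)
Lemma moved4P s : ~~ odd_perm s -> moved s = 4%N ->
  exists a b c e, uniq [:: a; b; c; e] /\ s = (tperm a b * tperm c e)%g.
Proof.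
move=> ev s4; have [|c [e [t [ce sE ts]]]] := @moved_mul_tperm s.
  by apply/eqP=> s1; rewrite s1 moved0 in s4.
have todd : odd_perm t by move: ev; rewrite sE odd_permM odd_tperm ce addbT negbK.
have [|a [b [u [ab tE ut]]]] := @moved_mul_tperm t.
  by apply: contraTneq todd => ->; rewrite odd_perm1.
have uev : ~~ odd_perm u by move: todd; rewrite tE odd_permM odd_tperm ab addbT.
have u1 : u = 1%g.
  apply/eqP/contraT => /moved_mul_tperm[x [y [v [xy uE vu]]]].
  have v1 : v = 1%g by apply: perm_eq1_moved; lia.
  by move: uev; rewrite uE v1 mul1g odd_tperm xy.
exists a, b, c, e; split; last by rewrite sE tE u1 mul1g.
apply/card_uniqP/eqP; rewrite eqn_leq card_size /= -s4; apply: subset_leq_card.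
apply/subsetP=> i; rewrite !inE sE tE u1 mul1g permM; apply: contraR.
rewrite !negb_or ![i == _]eq_sym => /and4P[ia ib ic ie].
by rewrite !tpermD.
Qed.

Lemma moved_weight_tperm (F : fieldType) (A : 'M[F]_n) a b : a != b ->
  moved_weight A (tperm a b) = A a b * A b a.
Proof.
move=> ab; rewrite /moved_weight (bigD1 a) ?tpermL 1?eq_sym //=.
rewrite (bigD1 b) ?tpermR ?[b == a]eq_sym ?ab //=.
rewrite big1 ?mulr1 ?mulrNN // => i /andP[/andP[ti ia] ib].
by rewrite tpermD ?eqxx 1?eq_sym in ti.
Qed.

Lemma moved_weight_tperm2 (F : fieldType) (A : 'M[F]_n) a b c e : uniq [:: a; b; c; e] ->
  moved_weight A (tperm a b * tperm c e)%g = (A a b * A b a) * (A c e * A e c).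
Proof.
move=> u; have [ab ac ae] : [/\ a != b, a != c & a != e].
  by move: u; rewrite /= !inE !negb_or => /andP[/and3P[]].
have [bc be ce] : [/\ b != c, b != e & c != e].
  by move: u; rewrite /= !inE !negb_or andbT => /and3P[_ /andP[]].
set s := (_ * _)%g.
have sa : s a = b by rewrite permM tpermL tpermD // eq_sym.
have sb : s b = a by rewrite permM tpermR tpermD // eq_sym.
have sc : s c = e by rewrite permM (tpermD ac bc) tpermL.
have se : s e = c by rewrite permM (tpermD ae be) tpermR.
have [ba ca ea] : [/\ b != a, c != a & e != a] by split; rewrite eq_sym.
have [cb eb ec] : [/\ c != b, e != b & e != c] by split; rewrite eq_sym.
rewrite /moved_weight (bigD1 a) ?sa //= (bigD1 b) ?sb ?ba ?ab //=.
rewrite (bigD1 c) ?sc ?ec ?ca ?cb //= (bigD1 e) ?se ?ce ?ea ?eb ?ec //=.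
rewrite big1 ?mulr1 => [|i]; first by ring.
case/andP=> /andP[/andP[/andP[si ia] ib] ic] ie.
by rewrite permM !tpermD ?eqxx 1?eq_sym in si.
Qed.

End SupportOfPermutation.

(** * The coefficients carried by one and two transpositions *)

Section ClassSums.

Variable n : nat.
Implicit Types s g : 'S_n.

Lemma moved_conj s g : moved (s ^ g)%g = moved s.
Proof.
rewrite /moved -!sum1_card big_mkcond [RHS]big_mkcond /= (reindex_inj (@perm_inj _ g)) /=.
apply: eq_bigr => i _; rewrite !inE permJ (inj_eq perm_inj) //.
Qed.

Lemma movedV s : moved (s^-1)%g = moved s.
Proof.
rewrite /moved -!sum1_card big_mkcond [RHS]big_mkcond /= (reindex_inj (@perm_inj _ s)) /=.
by apply: eq_bigr => i _; rewrite !inE permK eq_sym.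
Qed.

Lemma moved_weightV (F : fieldType) (A : 'M[F]_n) s : A^T = A ->
  moved_weight A (s^-1)%g = moved_weight A s.
Proof.
move=> AT; rewrite /moved_weight (reindex_inj (@perm_inj _ s)) /=.
by apply: eq_big => i; rewrite permK 1?eq_sym // -[in RHS]AT mxE.
Qed.

Lemma moved_tperm (a b : 'I_n) : a != b -> moved (tperm a b) = 2%N.
Proof.
move=> ab; have u : uniq [:: a; b] by rewrite /= inE ab.
rewrite -[2%N]/(size [:: a; b]) -(card_uniqP u); apply: eq_card => i.
rewrite !inE; case: tpermP => [->|->|/eqP/negPf-> /eqP/negPf->]; rewrite ?eqxx ?orbT //.
by rewrite eq_sym ab.
Qed.

Lemma moved_tperm2 (a b c e : 'I_n) : uniq [:: a; b; c; e] ->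
  moved (tperm a b * tperm c e)%g = 4%N.
Proof.
move=> u; rewrite -[4%N]/(size [:: a; b; c; e]) -(card_uniqP u); apply: eq_card => i.
rewrite !inE; apply/idP/idP.
  apply: contraR; rewrite !negb_or ![i == _]eq_sym => /and4P[ia ib ic ie].
  by rewrite permM !tpermD.
move: u; rewrite /= !inE !negb_or andbT => /and3P[/and3P[ab ac ae] /andP[bc be] ce].
case/or4P=> /eqP->; rewrite permM.
- by rewrite tpermL tpermD // eq_sym.
- by rewrite tpermR tpermD // eq_sym.
- by rewrite (tpermD ac bc) tpermL eq_sym.
- by rewrite (tpermD ae be) tpermR.
Qed.

(** On a conjugacy class D the class function chi is constant, and the sum of phi is
    proportional to its sum over all the conjugates of a representative. *)
Lemma sum_conj_class (R : comPzRingType) (D : pred 'S_n) s0 (chi phi : 'S_n -> R) :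
    (forall s g, chi (s ^ g)%g = chi s) ->
    (forall s g, D (s ^ g)%g = D s) ->
    (forall s, D s -> exists g, s = (s0 ^ g)%g) ->
  #|'S_n|%:R * (\sum_(s | D s) chi s * phi s)
    = #|D|%:R * chi s0 * \sum_g phi (s0 ^ g)%g.
Proof.
move=> chiJ DJ Ds0; rewrite mulrAC -mulrA mulr_natl -sumr_const.
transitivity (\sum_(g : 'S_n) \sum_(s | D s) chi s0 * phi (s ^ g)%g).
  apply: eq_bigr => g _; rewrite (reindex_inj (@conjg_inj _ g)) /=.
  by apply: eq_big => s; [exact: DJ | rewrite DJ chiJ => /Ds0[h ->]; rewrite chiJ].
rewrite exchange_big /= mulr_natl -sumr_const; apply: eq_bigr => s /Ds0[h ->].
rewrite mulrC mulr_sumr [RHS](reindex_inj (mulgI h)) /=.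
by apply: eq_bigr => g _; rewrite conjgM.
Qed.

End ClassSums.

Section HookImmanant.

Variables (n k : nat).
Hypothesis hk : (1 <= k <= n.+1)%N.
Variable F : numFieldType.
Notation la := (hook n.+1 k).
Notation chi := (@sym_char F n.+1 la).
Notation P A := (immanant la ('X%:M - map_mx polyC A) : {poly F}).

(** The properties of adjacency matrices on which the coefficients depend. *)
Definition adjacency_like (A : 'M[F]_n.+1) :=
  [/\ A^T = A, forall i, A i i = 0 & forall i j, A i j * A i j = A i j].

(** The permutations moving two points are the transpositions, a single class, so
    that c is chi at a transposition up to a positive factor. *)
Lemma coef_hook_immanant2 : n.+1 != k.*2.-1 ->
  exists2 c : F, c != 0 &
    forall A, adjacency_like A -> (P A)`_(n.+1 - 2) = c * pair_sum (fun i j => A i j).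
Proof.
move=> nk; have n2 : (1 < n.+1)%N by lia.
pose a : 'I_n.+1 := ord0; pose b : 'I_n.+1 := Ordinal n2; have ab : a != b by [].
pose D := [pred s : 'S_n.+1 | moved s == 2%N].
have Ds0 s : D s -> exists g, s = (tperm a b ^ g)%g.
  move=> /eqP/moved2P[x [y [xy ->]]].
  have [||//|g [gx gy]] := @perm_map_uniq _ [:: a; b] [:: x; y].
  - by [].
  - by rewrite /= inE xy.
  - by exists g; rewrite tpermJ gx gy.
pose u : F := #|[pred t : 2.-tuple 'I_n.+1 | uniq t]|%:R.
pose m : F := #|'S_n.+1|%:R.
have u0 : u != 0 by apply: card_uniq_tuple_neq0.
have m0 : m != 0 by apply: perm_card_neq0.
have D0 : #|D|%:R != 0 :> F.
  by rewrite pnatr_eq0 -lt0n; apply/card_gt0P; exists (tperm a b); rewrite inE /= moved_tperm.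
exists (#|D|%:R * chi (tperm a b) / u).
  by rewrite !mulf_neq0 ?invr_eq0 // hook_char_tperm_neq0 ?pair_sum_hook_neq0.
move=> A [AT A0 A2]; rewrite coef_immanant //.
have DE (s : 'S_n.+1) : (n.+1 - moved s == n.+1 - 2)%N = D s.
  by rewrite inE /=; have := moved_le s; lia.
rewrite (eq_bigl _ _ DE).
have := @sum_conj_class _ F D (tperm a b) chi (moved_weight A) (hook_charJ hk F) _ Ds0.
move=> /(_ (fun s g => congr1 (fun x => x == 2%N) (moved_conj s g))) S1.
have := @sum_perm_tuple F _ 2 (fun t => A (tnth t 0) (tnth t 1)) [tuple a; b].
move=> /(_ isT) S2.
have SE : \sum_g moved_weight A (tperm a b ^ g)%g = \sum_(g : 'S_n.+1) A (g a) (g b).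
  apply: eq_bigr => g _; rewrite tpermJ moved_weight_tperm ?(inj_eq perm_inj) //.
  by rewrite -[in A (g b)]AT mxE A2.
apply: (mulfI m0); rewrite S1 SE.
apply: (mulfI u0); rewrite mulrCA S2 -/m /pair_sum.
by rewrite mulrCA; field.
Qed.

(** The odd permutations with four moved points (the 4-cycles) cancel against their
    inverses; the even ones form the class of products of two disjoint
    transpositions. *)
Lemma coef_hook_immanant4 : n.+1 = k.*2.-1 -> (3 <= k)%N ->
  exists2 c : F, c != 0 &
    forall A, adjacency_like A -> (P A)`_(n.+1 - 4) = c * two_pair_sum (fun i j => A i j).
Proof.
move=> nk k3; have n4 : (3 < n.+1)%N by lia.
pose o i (i4 : (i < 4)%N) : 'I_n.+1 := Ordinal (leq_trans i4 n4).
pose a := @o 0%N isT; pose b := @o 1%N isT; pose c := @o 2%N isT; pose e := @o 3%N isT.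
have abce : uniq [:: a; b; c; e] by [].
pose s0 := (tperm a b * tperm c e)%g.
pose D := [pred s : 'S_n.+1 | (moved s == 4%N) && ~~ odd_perm s].
have Ds0 s : D s -> exists g, s = (s0 ^ g)%g.
  case/andP=> /eqP m4 /moved4P /(_ m4)[x [y [z [t [xyzt ->]]]]].
  have [//|//|//|g [gx gy gz gt]] := @perm_map_uniq _ [:: a; b; c; e] [:: x; y; z; t].
  by exists g; rewrite conjMg !tpermJ gx gy gz gt.
pose u : F := #|[pred t : 4.-tuple 'I_n.+1 | uniq t]|%:R.
pose m : F := #|'S_n.+1|%:R.
have u0 : u != 0 by apply: card_uniq_tuple_neq0.
have m0 : m != 0 by apply: perm_card_neq0.
have D0 : #|D|%:R != 0 :> F.
  rewrite pnatr_eq0 -lt0n; apply/card_gt0P; exists s0; rewrite inE /= moved_tperm2 //.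
  by rewrite odd_permM !odd_tperm.
exists (#|D|%:R * chi s0 / u).
  by rewrite !mulf_neq0 ?invr_eq0 // hook_char_tperm2_neq0 ?two_pair_sum_hook_neq0.
move=> A [AT A0 A2]; rewrite coef_immanant //.
have DE (s : 'S_n.+1) : (n.+1 - moved s == n.+1 - 4)%N = (moved s == 4%N).
  by have := moved_le s; lia.
rewrite (eq_bigl _ _ DE) (bigID (fun s => ~~ odd_perm s)) /=.
(* Inversion changes the sign of the sum over the odd permutations. *)
rewrite [X in _ + X](_ : _ = 0) ?addr0; last first.
  apply/eqP; rewrite -eqNr; apply/eqP; rewrite [RHS](reindex_inj invg_inj) /= -sumrN.
  apply: eq_big => s; first by rewrite movedV odd_permV.
  case/andP=> _ /negPn so.
  by rewrite hook_charV // moved_weightV // so expr1 mulN1r mulNr.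
have DJ s g : D (s ^ g)%g = D s by rewrite /D /= moved_conj odd_permJ.
have S1 := @sum_conj_class _ F D s0 chi (moved_weight A) (hook_charJ hk F) DJ Ds0.
have S2 := @sum_perm_tuple F _ 4
  (fun t => A (tnth t 0) (tnth t 1) * A (tnth t 2) (tnth t 3)) [tuple a; b; c; e] abce.
have SE : \sum_g moved_weight A (s0 ^ g)%g =
    \sum_(g : 'S_n.+1) A (g a) (g b) * A (g c) (g e).
  apply: eq_bigr => g _; rewrite conjMg !tpermJ moved_weight_tperm2.
    by rewrite -[in A (g b)]AT -[in A (g e)]AT !mxE !A2.
  by rewrite -[uniq _]/(uniq (map g [:: a; b; c; e])) (map_inj_uniq perm_inj).
apply: (mulfI m0); rewrite [LHS]S1 SE.
apply: (mulfI u0); rewrite mulrCA S2 -/m /two_pair_sum.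
by rewrite mulrCA; field.
Qed.

End HookImmanant.

(** * Degrees of regular graphs *)

Section RegularGraphs.

Variable F : numFieldType.

Lemma adjacency_like_adj_mx n (G : sgraph n.+1) : adjacency_like (adj_mx F G).
Proof.
split=> [|i|i j]; rewrite ?mxE ?adj_irr //.
  by apply/matrixP=> i j; rewrite !mxE adj_sym.
by rewrite -natrM mulnb andbb.
Qed.

Lemma sum_adj_mx n (G : sgraph n) i : \sum_j adj_mx F G i j = (deg G i)%:R.
Proof.
rewrite /deg cardsE -sum1_card natr_sum [RHS]big_mkcond /=.
by apply: eq_bigr => j _; rewrite mxE -[j \in G i]/(G i j); case: (G i j).
Qed.

Lemma pair_sum_regular n (G : sgraph n.+1) d : (forall v, deg G v = d) ->
  pair_sum (fun i j => adj_mx F G i j) = (n.+1 * d)%:R.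
Proof.
move=> Gd; have [_ A0 _] := adjacency_like_adj_mx G; rewrite pair_sumE //.
under eq_bigr => i _ do rewrite sum_adj_mx Gd.
by rewrite sumr_const card_ord -mulrnA mulnC.
Qed.

Lemma two_pair_sum_regular n (G : sgraph n.+1) d : (forall v, deg G v = d) ->
  two_pair_sum (fun i j => adj_mx F G i j)
    = n.+1%:R * d%:R * ((n.+1%:R - 4) * d%:R + 2).
Proof.
move=> Gd; have [AT A0 A2] := adjacency_like_adj_mx G; rewrite two_pair_sumE //; last first.
  by move=> i j; rewrite -[in LHS]AT mxE.
under eq_bigr => i _ do rewrite sum_adj_mx Gd.
under [X in _ - 4 * X]eq_bigr => i _ do rewrite sum_adj_mx Gd.
under [X in _ + 2 * X]eq_bigr => i _.
  under eq_bigr => j _ do rewrite expr2 A2.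
  rewrite sum_adj_mx Gd; over.
rewrite !sumr_const card_ord -[d%:R *+ _]mulr_natr -[d%:R ^+ 2 *+ _]mulr_natr; ring.
Qed.

(** This is the value of [two_pair_sum] at a d-regular graph; as N > 4 it increases
    strictly with d. *)
Lemma two_pair_count_inj (N d d' : nat) : (5 <= N)%N ->
  N%:R * d%:R * ((N%:R - 4) * d%:R + 2) = N%:R * d'%:R * ((N%:R - 4) * d'%:R + 2) :> F ->
  d = d'.
Proof.
move=> N5 /eqP; have N4 : N%:R - 4 = (N - 4)%N%:R :> F by rewrite natrB // (ltnW N5).
rewrite N4 -!natrM -!natrD -!natrM eqr_nat => /eqP E.
have N0 : (0 < N)%N by lia.
move: E; rewrite -!mulnA => /eqP; rewrite eqn_pmul2l // => /eqP E.
have mono x y : (x < y)%N -> (x * ((N - 4) * x + 2) < y * ((N - 4) * y + 2))%N.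
  move=> xy; apply: (@leq_ltn_trans (x * ((N - 4) * y + 2))%N).
    by rewrite leq_mul2l leq_add2r leq_mul2l (ltnW xy) !orbT.
  by rewrite ltn_pmul2r // addn2.
by case: (ltngtP d d') => // /mono; rewrite E ltnn.
Qed.

Lemma deg_lt n (G : sgraph n) v : (deg G v < n)%N.
Proof.
rewrite -[X in (_ < X)%N]card_ord; apply: proper_card; apply/properP; split.
  by apply/subsetP.
by exists v; rewrite // inE adj_irr.
Qed.

(** Any two of the three edges share a vertex, so the equality of the degrees makes
    all three edges present or all three absent. *)
Lemma regular3_complete (G : sgraph 3) d : (forall v, deg G v = d) ->
  exists b : bool, forall i j : 'I_3, G i j = b && (i != j).
Proof.
move=> Gd.
have degE v : deg G v = (\sum_j G v j)%N.
  rewrite /deg cardsE -sum1_card [LHS]big_mkcond; apply: eq_bigr => j _.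
  by rewrite -[j \in G v]/(G v j); case: (G v j).
pose o i (i3 : (i < 3)%N) : 'I_3 := Ordinal i3.
pose v0 := @o 0%N isT; pose v1 := @o 1%N isT; pose v2 := @o 2%N isT.
have sum3 v : (\sum_j G v j = G v v0 + G v v1 + G v v2)%N.
  rewrite !big_ord_recl big_ord0 addn0 addnA.
  by congr (G v _ + G v _ + G v _)%N; apply: val_inj.
have := Gd v0; have := Gd v1; have := Gd v2; rewrite !degE !sum3 !adj_irr.
rewrite (adj_sym G v1 v0) (adj_sym G v2 v0) (adj_sym G v2 v1) => d2 d1 d0.
have [e1 e2] : G v0 v1 = G v0 v2 /\ G v0 v1 = G v1 v2.
  by move: d0 d1 d2; do 3 case: (G _ _); lia.
exists (G v0 v1) => i j.
have all3 (x : 'I_3) : [\/ x = v0, x = v1 | x = v2].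
  case: x => [[|[|[|//]]] x3]; [apply: Or31|apply: Or32|apply: Or33]; exact: val_inj.
case: (all3 i) => ->; case: (all3 j) => ->; rewrite ?adj_irr ?andbF ?andbT //;
  by rewrite 1?adj_sym // -?e1 -?e2.
Qed.

End RegularGraphs.

Section DegreeFromImmanant.

Variable F : numFieldType.
Notation P la A := (immanant la ('X%:M - map_mx polyC A) : {poly F}).

(** At x = -1 the matrix is -J for a complete graph and -I for an empty one, so
    that the immanant is a multiple of the sum of chi, or of chi(1). *)
Lemma hook_immanant_complete n k (G : sgraph n.+1) (hk : (1 <= k <= n)%N) (b : bool) :
    (forall i j, G i j = b && (i != j)) ->
  (P (hook n.+1 k) (adj_mx F G)).[-1]
    = if b then 0 else (-1) ^+ n.+1 * sym_char F (hook n.+1 k) (1%g : 'S_n.+1).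
Proof.
move=> Gb.
have horner_imm : (P (hook n.+1 k) (adj_mx F G)).[-1] =
    \sum_(s : 'S_n.+1) sym_char F (hook n.+1 k) s *
      \prod_i (- (i == s i)%:R - (G i (s i))%:R).
  rewrite /immanant horner_sum; apply: eq_bigr => s _.
  rewrite hornerZ horner_prod; congr (_ * _); apply: eq_bigr => i _.
  rewrite !mxE hornerD hornerN hornerC hornerMn hornerX mulNrn //.
rewrite horner_imm; case: b Gb => Gb.
  transitivity (\sum_(s : 'S_n.+1) sym_char F (hook n.+1 k) s * (-1) ^+ n.+1).
    apply: eq_bigr => s _; congr (_ * _).
    rewrite -[X in _ ^+ X](card_ord n.+1) -prodr_const; apply: eq_bigr => i _.
    by rewrite Gb /=; case: eqP => _; rewrite /= ?subr0 // oppr0 add0r.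
  rewrite -mulr_suml sum_hook_char ?mul0r //; lia.
rewrite (bigD1 1%g) //= [X in _ + X]big1 ?addr0 => [|s s1].
  rewrite mulrC; congr (_ * _); rewrite -[X in _ ^+ X](card_ord n.+1) -prodr_const.
  by apply: eq_bigr => i _; rewrite perm1 eqxx Gb subr0.
have [i si] : exists i, s i != i.
  apply/existsP/contraT; rewrite negb_exists => /forallP sP; case/eqP: s1.
  by apply/permP=> i; rewrite perm1; apply/eqP/negPn/sP.
by rewrite (bigD1 i) //= Gb /= eq_sym (negPf si) oppr0 addr0 mul0r mulr0.
Qed.

(** Transpositions settle the hooks that are not self-conjugate, and pairs of
    disjoint transpositions the self-conjugate ones with k >= 3; there remain a
    single vertex and the hook (2,1). *)
Lemma degree_hook_immanant n k (G G' : sgraph n.+1) d d' : (1 <= k <= n.+1)%N ->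
    (forall v, deg G v = d) -> (forall v, deg G' v = d') ->
    P (hook n.+1 k) (adj_mx F G) = P (hook n.+1 k) (adj_mx F G') ->
  d = d'.
Proof.
move=> hk Gd Gd' PE.
have [nk|nk] := eqVneq n.+1 k.*2.-1; last first.
  have [c c0 cP] := coef_hook_immanant2 hk F nk.
  have := cP _ (adjacency_like_adj_mx F G); rewrite PE cP; last exact: adjacency_like_adj_mx.
  rewrite (pair_sum_regular _ Gd) (pair_sum_regular _ Gd') => /(mulfI c0)/eqP.
  by rewrite eqr_nat eqn_pmul2l // => /eqP.
have [k3|k3] := leqP 3 k.
  have [c c0 cP] := coef_hook_immanant4 hk F nk k3.
  have := cP _ (adjacency_like_adj_mx F G); rewrite PE cP; last exact: adjacency_like_adj_mx.
  rewrite (two_pair_sum_regular _ Gd) (two_pair_sum_regular _ Gd') => /(mulfI c0) E.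
  by apply/esym/(@two_pair_count_inj F n.+1); rewrite // nk; lia.
have [k1|k1] := eqVneq k 1%N.
  have n0 : n = 0%N by lia.
  have := deg_lt G ord0; have := deg_lt G' ord0; rewrite Gd Gd' n0; lia.
have k2 : k = 2%N by lia.
have n2 : n = 2%N by lia.
subst n k; have [b Gb] := regular3_complete Gd; have [b' Gb'] := regular3_complete Gd'.
have bb : b = b'.
  have chi1 := hook_char1_neq0 hk F.
  have := hook_immanant_complete (isT : (1 <= 2 <= 2)%N) Gb.
  rewrite PE (hook_immanant_complete (isT : (1 <= 2 <= 2)%N) Gb') => /eqP.
  case: (b); case: (b') => //.
    by rewrite mulf_eq0 signr_eq0 (negPf chi1).
  by rewrite eq_sym mulf_eq0 signr_eq0 (negPf chi1).
rewrite -(Gd ord0) -(Gd' ord0) /deg; congr #|pred_of_set _|.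
by apply/setP=> j; rewrite !inE Gb Gb' bb.
Qed.

(** A permutation other than 1 moves at least two points, so that only the identity
    contributes to this coefficient. *)
Lemma coef_immanant_XsubC n la (A : 'M[F]_n.+1) (c : F) : (forall i, A i i = 0) ->
  (immanant la (('X - c%:P)%:M - map_mx polyC A))`_n
    = - (sym_char F la (1%g : 'S_n.+1) * n.+1%:R * c).
Proof.
move=> A0; rewrite immanant_shifted // coef_sum (bigD1 1%g) //= big1 ?addr0 => [|s s1].
  rewrite moved0 subn0 coefZ /moved_weight big1 => [|i]; last by rewrite perm1 eqxx.
  rewrite mulr1.
  have := @coefPn_prod_XsubC F (nseq n.+1 c).
  rewrite size_nseq !big_nseq iter_mulr_1 iter_addr_0 => /(_ isT) ->.
  by rewrite mulrN -mulrA mulr_natl.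
rewrite coefZ nth_default ?mulr0 // size_exp_XsubC.
have : (1 < moved s)%N by rewrite ltnNge; apply: contra s1 => /perm_eq1_moved->.
by have := moved_le s; lia.
Qed.

End DegreeFromImmanant.

(** * The two immanantal polynomials of a regular graph *)

Lemma immanant_regularE (F : numFieldType) n la (G : sgraph n) d (beta gamma : F) :
    (forall v, deg G v = d) ->
  immanant la ('X%:M - map_mx polyC (beta *: deg_mx F G) - map_mx polyC (gamma *: adj_mx F G))
  = immanant la (('X - (beta * d%:R)%:P)%:M - map_mx polyC (gamma *: adj_mx F G)).
Proof.
move=> Gd; congr (immanant la (_ - _)); apply/matrixP=> i j; rewrite !mxE Gd.
by case: (i == j); rewrite ?mulr1n // !mulr0n mulr0 polyC0 subr0.
Qed.

(** For a common degree the two equalities correspond by a substitution and a change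
    of scale, so each of them only has to provide d = d'. *)
Lemma hook_immanant_regular (F : numFieldType) n k (beta gamma : F) (G G' : sgraph n) d d' :
    beta != 0 -> gamma != 0 -> (1 <= k <= n)%N ->
    (forall v, deg G v = d) -> (forall v, deg G' v = d') ->
  immanant (hook n k) ('X%:M - map_mx polyC (adj_mx F G))
    = immanant (hook n k) ('X%:M - map_mx polyC (adj_mx F G'))
  <-> immanant (hook n k) (('X - (beta * d%:R)%:P)%:M - map_mx polyC (gamma *: adj_mx F G))
    = immanant (hook n k) (('X - (beta * d'%:R)%:P)%:M - map_mx polyC (gamma *: adj_mx F G')).
Proof.
move=> beta0 gamma0; case: n k G G' => [|n] k G G' hk Gd Gd'; first by lia.
have diag0 (H : sgraph n.+1) i : adj_mx F H i i = 0 by rewrite mxE adj_irr.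
have diag0g (H : sgraph n.+1) i : (gamma *: adj_mx F H) i i = 0.
  by rewrite mxE diag0 mulr0.
have same_degree := iff_trans
  (immanant_shift_inj (hook n.+1 k) (beta * d%:R) (diag0g G) (diag0g G'))
  (immanant_scale_inj (hook n.+1 k) gamma0 (diag0 G) (diag0 G')).
split=> PE.
  by rewrite -(degree_hook_immanant hk Gd Gd' PE); apply/same_degree.
have dd : d = d'.
  have := coef_immanant_XsubC (hook n.+1 k) (beta * d'%:R) (diag0g G').
  rewrite -PE (coef_immanant_XsubC _ _ (diag0g G)) => /oppr_inj/mulfI.
  rewrite mulf_neq0 ?hook_char1_neq0 ?pnatr_eq0 // => /(_ isT)/(mulfI beta0)/eqP.
  by rewrite eqr_nat => /eqP.
by apply/same_degree; rewrite PE dd.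
Qed.

Theorem theorem4p4 (R : realType) (n k : nat) (beta gamma : R)
    (G G' : sgraph n) (hbeta : beta != 0) (hgamma : gamma != 0)
    (hG : regular G) (hG' : regular G') (hk : (1 <= k <= n)%N) :
  immanant (hook n k) ('X%:M - map_mx polyC (adj_mx R G)) =
  immanant (hook n k) ('X%:M - map_mx polyC (adj_mx R G'))
  <->
  immanant (hook n k) ('X%:M - map_mx polyC (beta *: deg_mx R G)
                             - map_mx polyC (gamma *: adj_mx R G)) =
  immanant (hook n k) ('X%:M - map_mx polyC (beta *: deg_mx R G')
                             - map_mx polyC (gamma *: adj_mx R G')).
Proof.
case: hG hG' => [d Gd] [d' Gd'].
rewrite (immanant_regularE _ _ _ Gd) (immanant_regularE _ _ _ Gd').
exact: hook_immanant_regular.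
Qed.
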